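(* For $n\geqslant 2$, $$\sum_{\pi\in\mathcal{S}_n}x^{\mathrm{exc}(\pi)}2^{n-\mathrm{cyc}(\pi)}=\sum_{i=0}^{\lfloor (n-1)/2\rfloor}\xi^+_{n,i}x^i(1+x)^{n-1-2i}+x\sum_{j=0}^{\lfloor (n-2)/2\rfloor}\xi^-_{n,j}x^j(1+x)^{n-2-2j},$$ where, letting $\mathcal{S}_{n,m}$ denote the set of permutations in $\mathcal{S}_n$ with exactly $m$ cycle runs, $$\xi^+_{n,i}=\sum_{\pi\in\mathcal{S}_{n,2i+1}}2^{\mathrm{crun}(\pi)-\mathrm{cyc}(\pi)}=\sum_{\pi\in\mathcal{S}_{n,2i+1}}4^{\mathrm{cpk}(\pi)},\qquad \xi^-_{n,j}=\sum_{\pi\in\mathcal{S}_{n,2j+2}}2^{\mathrm{crun}(\pi)-\mathrm{cyc}(\pi)}=\sum_{\pi\in\mathcal{S}_{n,2j+2}}4^{\mathrm{cpk}(\pi)}.$$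
   Context: For $\pi\in\mathcal{S}_n$, $\mathrm{exc}(\pi)=\#\{i:\pi(i)>i\}$ and $\mathrm{cyc}(\pi)$ is the number of cycles. Write each cycle $w$ of $\pi$ in canonical form $w=y_1y_2\cdots y_j$ where $y_1$ is the smallest element of the cycle and $y_i=\pi^{i-1}(y_1)$; set $y_{j+1}=+\infty$. A cycle peak of $w$ is an entry $y_i$ with $2\leqslant i\leqslant j$ and $y_{i-1}<y_i>y_{i+1}$; $\mathrm{cpk}(w)$ is their number. The number of cycle runs $\mathrm{crun}(w)$ is the number of alternating runs (maximal consecutive increasing or decreasing subsequences) of the word $y_1y_2\cdots y_j(+\infty)$. For $\pi$ with cycles $w_1,\dots,w_s$, $\mathrm{crun}(\pi)=\sum_i\mathrm{crun}(w_i)$ and $\mathrm{cpk}(\pi)=\sum_i\mathrm{cpk}(w_i)$. *)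

(* Defs.v *)
From mathcomp Require Import all_boot all_order all_algebra all_fingroup.
Set Implicit Arguments.
Unset Strict Implicit.
Unset Printing Implicit Defensive.

Definition exc (n : nat) (s : 'S_n) : nat := #|[set i : 'I_n | i < s i]|.

Definition cyc (n : nat) (s : 'S_n) : nat := #|porbits s|.

(* The canonical word y_1 y_2 ... y_j of the cycle with support C, where
   y_1 = min C; the default branch is unreachable when C is in porbits s. *)
Definition cycle_word (n : nat) (s : 'S_n) (C : {set 'I_n}) : seq nat :=
  if [pick y in C | [forall z in C, y <= z]] is Some y
  then [seq val z | z <- traject s y #|C|] else [::].

(* The letters are 0, ..., n.-1, so the number n serves as +oo. *)
Definition closed_cycle_word (n : nat) (s : 'S_n) (C : {set 'I_n}) : seq nat :=
  rcons (cycle_word s C) n.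

Definition monotone_word (v : seq nat) : bool := sorted ltn v || sorted gtn v.

(* A pair (i, j) with i <= j < size v stands for the factor v_i ... v_j
   of v, positions being numbered from 0. *)
Definition factors (v : seq nat) : seq (nat * nat) :=
  [seq (i, j) | i <- iota 0 (size v), j <- iota i (size v - i)].

Definition monotone_factor (v : seq nat) (p : nat * nat) : bool :=
  monotone_word (take (p.2 - p.1).+1 (drop p.1 v)).

Definition is_alternating_run (v : seq nat) (p : nat * nat) : bool :=
  monotone_factor v p &&
  all (fun q => [&& monotone_factor v q, q.1 <= p.1 & p.2 <= q.2] ==> (q == p))
      (factors v).

Definition alternating_runs (v : seq nat) : nat :=
  count (is_alternating_run v) (factors v).

Definition peaks (v : seq nat) : nat :=
  count (fun i => (nth 0 v i.-1 < nth 0 v i) && (nth 0 v i.+1 < nth 0 v i))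
        (iota 1 (size v - 2)).

Definition crun (n : nat) (s : 'S_n) : nat :=
  \sum_(C in porbits s) alternating_runs (closed_cycle_word s C).

(* An entry of y_1 ... y_j (+oo) has two neighbours exactly when it is one of
   y_2, ..., y_j, so peaks counts the cycle peaks. *)
Definition cpk (n : nat) (s : 'S_n) : nat :=
  \sum_(C in porbits s) peaks (closed_cycle_word s C).

Definition perms_crun (n m : nat) : {set 'S_n} := [set s : 'S_n | crun s == m].

(* The subtraction does not truncate: each cycle has at least one run. *)
Definition xi_plus (n i : nat) : nat :=
  \sum_(s in perms_crun n (2 * i + 1)) 2 ^ (crun s - cyc s).

Definition xi_minus (n j : nat) : nat :=
  \sum_(s in perms_crun n (2 * j + 2)) 2 ^ (crun s - cyc s).

(* Main.v *)
(** Put m = crun(s) = 2 cpk(s) + cyc(s). The right-hand side is the sum over s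
    of 4^cpk(s) X^(m/2) (1 + X)^(n - m), with m/2 rounded down. Inserting a new
    largest letter into s changes the statistics as follows: as a fixed point it
    adds 1 to m; after a letter i it keeps cpk for exactly m of the n letters i
    (the last letter of a cycle word, and the two positions next to each peak)
    and adds one peak for the other n - m. Hence both sides satisfy
    p_(n+1) = (1 + 2nX) p_n + 2X(1 - X) p_n', with p_0 = 1. *)
Require Import Defs.
From mathcomp Require Import all_boot all_order all_algebra all_fingroup.
From mathcomp Require Import zify ring.
Import GRing.Theory.

Local Open Scope nat_scope.

(** * Alternating runs and peaks of a word *)

Definition up (v : seq nat) (k : nat) : bool := nth 0 v k < nth 0 v k.+1.

Definition adjacent_distinct (v : seq nat) : Prop :=
  forall k, k.+1 < size v -> nth 0 v k != nth 0 v k.+1.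

Definition turn (v : seq nat) (i : nat) : bool := up v i.-1 != up v i.

Definition constant_direction (v : seq nat) (i j : nat) : Prop :=
  exists b, forall k, i <= k < j -> up v k = b.

(** Adjacent letters differ, so a failed ascent is a strict descent and a constant value of [up] is
    the same as strict monotonicity. *)
Lemma monotone_factorP (v : seq nat) (i j : nat) :
  adjacent_distinct v -> i <= j < size v ->
  reflect (constant_direction v i j) (monotone_factor v (i, j)).
Proof.
move=> adj /andP[leij ltj]; set w := take (j - i).+1 (drop i v).
have sz : size w = (j - i).+1 by rewrite size_take size_drop; case: ifP; lia.
have nthw k : k <= j - i -> nth 0 w k = nth 0 v (i + k).
  by move=> ?; rewrite nth_take ?ltnS // nth_drop.
apply: (iffP orP) => [[/(sortedP 0) mono|/(sortedP 0) mono]|[[] dir]].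
- exists true => k lek; have := mono (k - i).
  rewrite sz !nthw; [|lia..]; rewrite /up.
  have ->: i + (k - i) = k by lia.
  have ->: i + (k - i).+1 = k.+1 by lia.
  by apply; lia.
- exists false => k lek; have := mono (k - i).
  rewrite sz !nthw; [|lia..]; rewrite /up.
  have ->: i + (k - i) = k by lia.
  have ->: i + (k - i).+1 = k.+1 by lia.
  by rewrite /gtn /=; lia.
- left; apply/(sortedP 0) => k; rewrite sz => ltk; rewrite !nthw; [|lia..].
  by have := dir (i + k); rewrite /up addnS; apply; lia.
- right; apply/(sortedP 0) => k; rewrite sz => ltk; rewrite !nthw; [|lia..].
  have /= := dir (i + k); rewrite /up addnS /gtn /=.
  by have := adj (i + k); lia.
Qed.

Lemma mem_factors (v : seq nat) (i j : nat) :
  ((i, j) \in factors v) = (i <= j < size v).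
Proof.
apply/allpairsPdep/idP => [[a [b [Ha Hb [-> ->]]]]|lt].
  by move: Ha Hb; rewrite !mem_iota; lia.
by exists i, j; rewrite !mem_iota; split=> //; lia.
Qed.

(** The only run that can start at [i] is the longest monotone factor from [i]. It is a run unless
    it extends to the left, which is impossible exactly at position 0 and at interior turns. *)
Lemma sum_runs_from (v : seq nat) (i : nat) :
  adjacent_distinct v -> 1 < size v -> i < size v ->
  \sum_(j <- iota i (size v - i)) is_alternating_run v (i, j)
    = (i == 0) || (i.+1 < size v) && turn v i.
Proof.
move=> adj sz lti; set start := (X in _ = nat_of_bool X).
pose P j := (i <= j < size v) && monotone_factor v (i, j).
have exP : exists j, P j.
  exists i; rewrite /P lti leqnn /=; apply/monotone_factorP => //; first by lia.
  by exists true => k; lia.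
have boundP j : P j -> j <= size v by rewrite /P; lia.
case: (ex_maxnP exP boundP) => m /andP[lem /monotone_factorP Mm] maxm.
have {}Mm := Mm adj lem.
have nextm : i.+1 < size v -> i.+1 <= m.
  move=> lti1; apply: maxm; rewrite /P leqnSn lti1 /=.
  apply/monotone_factorP => //; first by lia.
  by exists (up v i) => k ?; have ->: k = i by lia.
have runE j : i <= j < size v ->
    is_alternating_run v (i, j) = (j == m) && start.
  move=> lej; apply/idP/idP => [/andP[Mj /allP allj]|/andP[/eqP-> Hs]].
    have lejm : j <= m by apply: maxm; rewrite /P lej.
    have ejm : j = m.
      have := allj (i, m); rewrite mem_factors lem /= leqnn lejm.
      by move/monotone_factorP: Mm => ->//= /(_ isT) /eqP[].
    rewrite ejm eqxx /=; rewrite ejm in lej Mj allj.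
    rewrite /start; case: (posnP i) => // i_gt0 /=.
    have nM : ~ constant_direction v i.-1 m.
      move=> Hm; have := allj (i.-1, m); rewrite mem_factors /= leqnn leq_pred.
      have lem' : i.-1 <= m < size v by lia.
      have /monotone_factorP-> // := Hm.
      by rewrite lem' => /(_ isT)/eqP[]; lia.
    (* The last letter alone extends to the left: two adjacent letters always form a monotone
       factor. *)
    case: (ltnP i.+1 (size v)) => /= [lti1|gei1]; last first.
      by case: nM; exists (up v i.-1) => k ?; have ->: k = i.-1 by lia.
    apply/negP=> /eqP eqt; apply: nM.
    have := nextm lti1; case: Mm => b Hb ?; exists b => k lek.
    case: (ltnP k i) => ?; last by apply: Hb; lia.
    have ->: k = i.-1 by lia.
    by rewrite eqt; apply: Hb; lia.
  apply/andP; split; first exact/monotone_factorP.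
  apply/allP=> -[a b]; rewrite mem_factors => leab.
  apply/implyP => /and3P[/= /monotone_factorP Mab leai lemb].
  have {}[d Hd] := Mab adj leab.
  (* The part of [(a, b)] from [i] on is monotone, so the choice of [m] gives [b = m]; then [a < i]
     would contradict the turn at [i]. *)
  have ebm : b = m.
    apply/eqP; rewrite eqn_leq lemb andbT; apply: maxm; rewrite /P.
    have leib : i <= b < size v by lia.
    by rewrite leib; apply/monotone_factorP => //; exists d => k ?; apply: Hd; lia.
  rewrite ebm; case: (ltngtP a i) leai => // [ltai|->] _; last exact: eqxx.
  move: Hs; rewrite /start; have -> /= : (i == 0) = false by lia.
  case/andP=> /nextm ltim; rewrite /turn !Hd ?eqxx //; lia.
rewrite (eq_big_seq (fun j => if j == m then start : nat else 0)); last first.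
  by move=> j; rewrite mem_iota => lej; rewrite runE; [case: ifP|lia].
by rewrite -/(index_iota i (size v)) -big_mkcond /= big_nat1_eq lem.
Qed.

Definition valleys (v : seq nat) : nat :=
  \sum_(1 <= i < (size v).-1) (~~ up v i.-1 && up v i).

Lemma peaksE (v : seq nat) : adjacent_distinct v ->
  peaks v = \sum_(1 <= i < (size v).-1) (up v i.-1 && ~~ up v i).
Proof.
move=> adj; rewrite /peaks -sum1_count big_mkcond /= /index_iota.
have -> : (size v).-1 - 1 = size v - 2 by lia.
apply: eq_big_seq => i; rewrite mem_iota => lei.
have := adj i; have -> : i = i.-1.+1 by lia.
by rewrite /up /=; case: ifP; lia.
Qed.

Lemma alternating_runs_turns (v : seq nat) :
  adjacent_distinct v -> 1 < size v ->
  alternating_runs v = (\sum_(1 <= i < (size v).-1) turn v i).+1.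
Proof.
move=> adj sz; rewrite /alternating_runs -sum1_count big_mkcond /=.
rewrite big_allpairs_dep /=.
rewrite (eq_big_seq
  (fun i => (i == 0) || (i.+1 < size v) && turn v i : nat)); last first.
  by move=> i; rewrite mem_iota => lti; rewrite -sum_runs_from //.
(* Position 0 always starts a run and the last position never does; splitting off both leaves the
   interior turns. *)
have -> : size v = (size v).-2.+2 by lia.
rewrite -[in iota _ _](subn0 (size v).-2.+2) -/(index_iota 0 _).
rewrite (@big_nat_recr nat 0 addn) // ltnn /=.
rewrite addn0 /index_iota subn0 big_cons add1n /index_iota subn1; congr _.+1.
rewrite [RHS]big_seq [LHS]big_seq; apply: eq_bigr => i; rewrite mem_iota => lei.
have -> : i.+1 < (size v).-2.+2 by lia.
by have -> : (i == 0) = false by lia.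
Qed.

(** Peaks and valleys alternate, so equal first and last directions force equal numbers of them;
    [tele] is this balance on every prefix. *)
Lemma peaks_valleys (v : seq nat) :
  adjacent_distinct v -> 1 < size v -> up v 0 = up v (size v).-2 ->
  peaks v = valleys v.
Proof.
move=> adj sz eq_up; rewrite peaksE // /valleys.
have tele k : \sum_(1 <= i < k.+1) (up v i.-1 && ~~ up v i) + up v k
            = \sum_(1 <= i < k.+1) (~~ up v i.-1 && up v i) + up v 0.
  elim: k => [|k IHk]; first by rewrite !big_geq.
  rewrite !(@big_nat_recr _ _ _ k.+1) //=.
  by move: IHk; case: (up v k); case: (up v k.+1) => /=; lia.
have := tele (size v).-2; rewrite -eq_up => /addIn.
by have -> : (size v).-2.+1 = (size v).-1 by lia.
Qed.

Lemma alternating_runs_peaks (v : seq nat) :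
  adjacent_distinct v -> 1 < size v -> up v 0 = up v (size v).-2 ->
  alternating_runs v = (2 * peaks v).+1.
Proof.
move=> adj sz eq_up; rewrite alternating_runs_turns // mul2n -addnn.
rewrite {2}peaks_valleys // peaksE // /valleys -big_split /=; congr _.+1.
by apply: eq_bigr => i _; rewrite /turn; case: (up v i.-1); case: (up v i).
Qed.

(** * Cycle minima and cycle peaks *)

Definition cycle_min {n : nat} (s : 'S_n) (x : 'I_n) : bool :=
  [forall y in porbit s x, x <= y].

(** The last letter of a cycle word is followed by +oo, although its image under [s] is the cycle
    minimum; the third conjunct excludes it. *)
Definition cycle_peak {n : nat} (s : 'S_n) (x : 'I_n) : bool :=
  [&& (s^-1)%g x < x, s x < x & ~~ cycle_min s (s x)].

Lemma cycle_minP {n : nat} {s : 'S_n} {x : 'I_n} :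
  reflect (forall y, y \in porbit s x -> x <= y) (cycle_min s x).
Proof. exact: forall_inP. Qed.

Lemma cycle_min_inj {n : nat} {s : 'S_n} {x y : 'I_n} :
  cycle_min s x -> cycle_min s y -> y \in porbit s x -> x = y.
Proof.
move=> /cycle_minP minx /cycle_minP miny yx; apply: val_inj => /=.
by apply/eqP; rewrite eqn_leq minx // miny // porbit_sym.
Qed.

Lemma porbits_min {n : nat} (s : 'S_n) (C : {set 'I_n}) :
  C \in porbits s -> exists2 y, cycle_min s y & C = porbit s y.
Proof.
case/imsetP=> x _ ->; have [y yx miny] := arg_minnP val (porbit_id s x).
have eqC : porbit s x = porbit s y by apply/eqP; rewrite eq_porbit_mem porbit_sym.
by exists y => //; apply/cycle_minP => z; rewrite -eqC; apply: miny.
Qed.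

Lemma cyc_cycle_min {n : nat} (s : 'S_n) : cyc s = \sum_x cycle_min s x.
Proof.
have -> : \sum_x cycle_min s x = #|[set x | cycle_min s x]|.
  by rewrite -sum1dep_card [RHS]big_mkcond.
rewrite /cyc -(@card_in_imset _ _ (porbit s)).
  apply: eq_card => C; apply/idP/imsetP => [/porbits_min[y miny ->]|[y _ ->]].
    by exists y; rewrite ?inE.
  exact: imset_f.
move=> x y; rewrite !inE => minx miny /eqP; rewrite eq_porbit_mem => xy.
by apply: (cycle_min_inj minx miny); rewrite porbit_sym.
Qed.

Lemma cycle_word_min {n : nat} (s : 'S_n) (y : 'I_n) : cycle_min s y ->
  cycle_word s (porbit s y) =
    [seq val z | z <- traject s y #|porbit s y|].
Proof.
move=> miny; rewrite /cycle_word; case: pickP => [z /andP[zy /forall_inP minz]|].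
  suff -> : z = y by [].
  apply/esym/(cycle_min_inj miny) => //; apply/cycle_minP => u.
  have /eqP -> : porbit s z == porbit s y by rewrite eq_porbit_mem.
  exact: minz.
by move/(_ y); rewrite porbit_id (_ : [forall _ in _, _]).
Qed.

Section Cycle.
Context {n : nat} {s : 'S_n} {y : 'I_n} (miny : cycle_min s y).
Let C := porbit s y.
Let k := #|C|.
Let w := closed_cycle_word s C.

Lemma size_closed_cycle_word : size w = k.+1.
Proof. by rewrite size_rcons cycle_word_min // size_map size_traject. Qed.

Lemma nth_closed_cycle_word i :
  nth 0 w i = if i < k then val (iter i s y) else if i == k then n else 0.
Proof.
rewrite nth_rcons cycle_word_min // size_map size_traject -/C -/k.
case: ifP => // ltik.
by rewrite (nth_map y) ?size_traject // nth_traject.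
Qed.

Lemma iter_cycle_neq i j : i < j < k -> iter i s y != iter j s y.
Proof.
move=> ltij; have := nth_uniq y _ _ (uniq_traject_porbit s y) (i := i) (j := j).
rewrite size_traject !nth_traject -/C -/k; [|lia..] => ->; lia.
Qed.

Lemma iter_in_cycle i : iter i s y \in C.
Proof. by rewrite -permX mem_porbit. Qed.

Lemma cycle_min_iterS i : i < k -> cycle_min s (iter i.+1 s y) = (i.+1 == k).
Proof.
move=> ltik; apply/idP/eqP => [mini|->]; last by rewrite iter_porbit.
apply/eqP; case: (ltngtP i.+1 k) => // ltk; last by lia.
have /= := @iter_cycle_neq 0 i.+1; rewrite ltk => /(_ isT)/eqP[].
exact/(cycle_min_inj miny mini)/iter_in_cycle.
Qed.

Lemma closed_cycle_word_adjacent : adjacent_distinct w.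
Proof.
move=> i; rewrite size_closed_cycle_word => lti; rewrite !nth_closed_cycle_word.
have -> : i < k by lia.
case: ltnP => ?; first by rewrite (inj_eq val_inj) iter_cycle_neq //; lia.
have -> : i.+1 == k by lia.
by rewrite neq_ltn ltn_ord.
Qed.

Lemma card_cycle_gt0 : 0 < k. Proof. by rewrite lt0n card_porbit_neq0. Qed.

Lemma up_first : up w 0.
Proof.
have := @closed_cycle_word_adjacent 0; rewrite size_closed_cycle_word /up.
rewrite !nth_closed_cycle_word ltnS card_cycle_gt0 => /(_ isT).
(* In a cycle of length 1 the second letter is the closing [n]. *)
case: ifP => [_|ltk]; last first.
  by have := card_cycle_gt0; have := ltn_ord y; case: ifP => /=; lia.
rewrite ltn_neqAle => -> /=; have /cycle_minP := miny; apply.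
exact: (iter_in_cycle 1).
Qed.

Lemma up_last : up w k.-1.
Proof.
rewrite /up !nth_closed_cycle_word.
have -> : k.-1.+1 = k by have := card_cycle_gt0; lia.
by rewrite leqnn ltnn eqxx ltn_ord.
Qed.

Lemma peaks_closed_cycle_word : peaks w = \sum_(x in C) cycle_peak s x.
Proof.
rewrite peaksE ?size_closed_cycle_word /=; last exact: closed_cycle_word_adjacent.
have -> : \sum_(x in C) cycle_peak s x =
    \sum_(x <- traject s y k) cycle_peak s x.
  rewrite [RHS]big_uniq ?uniq_traject_porbit //=.
  by apply: eq_bigl => x; rewrite porbit_traject.
rewrite (big_nth y) size_traject.
rewrite [RHS]big_ltn ?card_cycle_gt0 // nth_traject ?card_cycle_gt0 //=.
(* [peaks] starts at position 1; nothing is lost, since the minimum does not exceed its preimage. *)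
have -> : cycle_peak s y = false.
  apply/negP=> /and3P[lty _ _].
  have /cycle_minP/(_ (s^-1%g y)) := miny.
  rewrite -porbitV -[X in X \in _]/((s^-1)%g y) (mem_porbit _ 1); lia.
rewrite add0n; apply: eq_big_nat => i lei; rewrite nth_traject; last by lia.
case: i lei => // i lei; rewrite /cycle_peak /= permK -/(iter i.+1 s y).
rewrite -/(iter i.+2 s y) cycle_min_iterS; last by lia.
rewrite /up !nth_closed_cycle_word.
have -> : i < k by lia.
have -> : i.+1 < k by lia.
congr (_ && _).
case: (ltnP i.+2 k) => ?.
  have -> : (i.+2 == k) = false by lia.
  rewrite andbT -leqNgt leq_eqVlt (inj_eq val_inj) eq_sym.
  by rewrite (negbTE (iter_cycle_neq i.+1 i.+2 _)) //; lia.
(* At the last letter both sides fail: the word rises to [n], and the next element of the cycle is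
   its minimum. *)
have -> : i.+2 == k by lia.
by rewrite ltn_ord andbF.
Qed.

Lemma alternating_runs_closed_cycle_word : alternating_runs w = (2 * peaks w).+1.
Proof.
apply: alternating_runs_peaks; rewrite ?size_closed_cycle_word ?ltnS ?card_cycle_gt0 //.
  exact: closed_cycle_word_adjacent.
by rewrite up_first up_last.
Qed.

End Cycle.

Lemma cpk_cycle_peak {n : nat} (s : 'S_n) : cpk s = \sum_x cycle_peak s x.
Proof.
rewrite (partition_big (porbit s) (mem (porbits s))) /=; last first.
  by move=> x _; apply: imset_f.
apply: eq_bigr => C /porbits_min[y miny ->].
by rewrite peaks_closed_cycle_word //; apply: eq_bigl => x; rewrite eq_porbit_mem.
Qed.

Lemma crun_cpk {n : nat} (s : 'S_n) : crun s = 2 * cpk s + cyc s.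
Proof.
rewrite /crun /cpk /cyc big_distrr -sum1_card -big_split /=.
apply: eq_bigr => C /porbits_min[y miny ->].
by rewrite alternating_runs_closed_cycle_word // addn1.
Qed.

(** * Insertion of a largest letter *)

(** Serves to compare cycles before and after an insertion, in both directions: a step of [t] need
    only stay inside a cycle of [s]. *)
Lemma porbit_homo {T T' : finType} {t : {perm T}} {s : {perm T'}} {r : T -> T'} :
  (forall z, r (t z) \in porbit s (r z)) ->
  forall u z, u \in porbit t z -> r u \in porbit s (r z).
Proof.
move=> rt u z /porbitP[k ->] {u}; rewrite permX.
elim: k => [|k IHk] /=; first exact: porbit_id.
move: IHk; rewrite -!eq_porbit_mem => /eqP <-.
by rewrite eq_porbit_mem.
Qed.

Lemma sum_lift_max {n : nat} (F : 'I_n.+1 -> nat) :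
  \sum_x F x = \sum_x F (lift ord_max x) + F ord_max.
Proof.
rewrite big_ord_recr; congr (_ + _); apply: eq_bigr => x _.
by congr F; apply: val_inj; apply: esym (lift_max x).
Qed.

(* Inserts the new largest letter after i in its cycle, as a fixed point when
   i is itself the new letter. *)
Definition insert_max {n : nat} (s : 'S_n) (i : 'I_n.+1) : 'S_n.+1 :=
  (tperm i ord_max * lift_perm ord_max ord_max s)%g.

Section InsertMax.
Context {n : nat} (s : 'S_n).
Implicit Types i x : 'I_n.
Local Notation max := (@ord_max n).

Lemma lift_neq_max x : (lift max x == max) = false.
Proof. by rewrite eq_sym (negbTE (neq_lift _ _)). Qed.

Lemma lift_lt_max x : lift max x < max.
Proof. by rewrite lift_max ltn_ord. Qed.

Lemma insert_max_at (i : 'I_n.+1) : insert_max s i i = max.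
Proof. by rewrite permM tpermL lift_perm_id. Qed.

Lemma insert_fixed x : insert_max s max (lift max x) = lift max (s x).
Proof. by rewrite /insert_max tperm1 mul1g lift_perm_lift. Qed.

Lemma insert_lift i x :
  insert_max s (lift max i) (lift max x) = if x == i then max else lift max (s x).
Proof.
case: eqP => [->|/eqP nxi]; first exact: insert_max_at.
rewrite permM tpermD ?lift_perm_lift //.
  by rewrite (inj_eq lift_inj) eq_sym.
by rewrite eq_sym lift_neq_max.
Qed.

Lemma insert_max_next i : insert_max s (lift max i) max = lift max (s i).
Proof. by rewrite permM tpermR lift_perm_lift. Qed.

Lemma insert_fixedV x :
  (insert_max s max)^-1%g (lift max x) = lift max ((s^-1)%g x).
Proof. by apply: (@perm_inj _ (insert_max s max)); rewrite permKV insert_fixed permKV. Qed.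

Lemma insert_liftV i x :
  (insert_max s (lift max i))^-1%g (lift max x)
    = if x == s i then max else lift max ((s^-1)%g x).
Proof.
apply: (@perm_inj _ (insert_max s (lift max i))); rewrite permKV.
case: eqP => [->|nx]; first by rewrite insert_max_next.
rewrite insert_lift permKV; case: eqP => // e; case: nx.
by rewrite -e permKV.
Qed.

Lemma insert_maxV (i : 'I_n.+1) : (insert_max s i)^-1%g max = i.
Proof. by apply: (@perm_inj _ (insert_max s i)); rewrite permKV insert_max_at. Qed.

Lemma porbit_insert_max (i : 'I_n.+1) x y :
  (lift max y \in porbit (insert_max s i) (lift max x)) = (y \in porbit s x).
Proof.
set t := insert_max s i; apply/idP/idP => [|yx]; last first.
  apply: porbit_homo yx => z; rewrite /t; case: (unliftP max i) => [j|] ->.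
    case: (eqVneq z j) => [->|nzj].
      (* The step of [s] from [j] now passes through the new letter and takes two steps. *)
      have := mem_porbit (insert_max s (lift max j)) 2 (lift max j).
      by rewrite expgS expg1 permM insert_max_at insert_max_next.
    have := mem_porbit (insert_max s (lift max j)) 1 (lift max z).
    by rewrite expg1 insert_lift (negbTE nzj).
  have := mem_porbit (insert_max s max) 1 (lift max z).
  by rewrite expg1 insert_fixed.
(* This retraction sends the new letter to its predecessor. If the new letter is a fixed point, its
   image is arbitrary and [x] is chosen. *)
pose r z := odflt (odflt x (unlift max i)) (unlift max z).
have rl z : r (lift max z) = z by rewrite /r liftK.
have rmax : r max = odflt x (unlift max i) by rewrite /r unlift_none.
rewrite -{2}(rl y) -{2}(rl x); apply: porbit_homo => z; rewrite /t.
case: (unliftP max i) => [j|] ei; rewrite ei ?liftK ?unlift_none /= in rmax *.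
  case: (unliftP max z) => [u|] ->.
    rewrite insert_lift; case: eqP => [->|_]; first by rewrite rmax rl porbit_id.
    by rewrite !rl (mem_porbit s 1).
  by rewrite insert_max_next rl rmax (mem_porbit s 1).
case: (unliftP max z) => [u|] ->.
  by rewrite insert_fixed !rl (mem_porbit s 1).
by rewrite insert_max_at rmax porbit_id.
Qed.

Lemma cycle_min_insert_lift (i : 'I_n.+1) x :
  cycle_min (insert_max s i) (lift max x) = cycle_min s x.
Proof.
apply/cycle_minP/cycle_minP => minx y yx.
  by have := minx (lift max y); rewrite porbit_insert_max !lift_max; apply.
case: (unliftP max y) yx => [z ->|-> _]; last exact/ltnW/lift_lt_max.
by rewrite porbit_insert_max !lift_max; apply: minx.
Qed.

Lemma cycle_min_insert_max (i : 'I_n.+1) :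
  cycle_min (insert_max s i) max = (i == max).
Proof.
apply/cycle_minP/eqP => [minm|->].
  case: (unliftP max i) minm => [j|] -> // /(_ (lift max (s j))).
  rewrite -(insert_max_next j) (mem_porbit _ 1) => /(_ isT).
  by rewrite insert_max_next leqNgt lift_lt_max.
move=> y /porbitP[k ->]; rewrite permX.
suff -> : iter k (insert_max s max) max = max by [].
by elim: k => //= k ->; apply: insert_max_at.
Qed.

Lemma cyc_insert_max (i : 'I_n.+1) :
  cyc (insert_max s i) = cyc s + (i == max).
Proof.
rewrite !cyc_cycle_min sum_lift_max cycle_min_insert_max; congr (_ + _).
by apply: eq_bigr => x _; rewrite cycle_min_insert_lift.
Qed.

Lemma cpk_insert_fixed : cpk (insert_max s max) = cpk s.
Proof.
rewrite !cpk_cycle_peak sum_lift_max {2}/cycle_peak insert_max_at ltnn andbF addn0.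
apply: eq_bigr => x _; rewrite /cycle_peak insert_fixed insert_fixedV !lift_max.
by rewrite cycle_min_insert_lift.
Qed.

(* The letters i for which inserting the new letter after i creates no peak:
   either i ends its cycle word, or the new peak replaces the peak i or s i. *)
Definition keeps_peaks i : bool :=
  [|| cycle_min s (s i), cycle_peak s i | cycle_peak s (s i)].

Lemma cycle_peak_adjacent i : cycle_peak s i -> cycle_peak s (s i) = false.
Proof.
by case/and3P=> _ lti _; rewrite /cycle_peak permK ltnNge (ltnW lti).
Qed.

(** The three alternatives exclude one another: two consecutive letters are not both peaks, a peak
    [i] has [s i] not minimal by definition, and a peak [s i] exceeds [i]. *)
Lemma keeps_peaksE i : keeps_peaks i =
  cycle_min s (s i) + (cycle_peak s i + cycle_peak s (s i)) :> nat.
Proof.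
rewrite /keeps_peaks; case: (boolP (cycle_peak s i)) => [pi|_].
  by rewrite cycle_peak_adjacent //; case/and3P: pi => _ _ /negbTE->.
case: (boolP (cycle_peak s (s i))) => [/and3P[+ _ _]|_]; last by case: cycle_min.
rewrite permK; case: (boolP (cycle_min s (s i))) => // /cycle_minP min_si lti.
by have := min_si i; rewrite leqNgt lti porbit_sym (mem_porbit s 1) => /(_ isT).
Qed.

(** Each cycle has one last letter, and each peak is counted at itself and at its predecessor. By
    [crun_cpk] the total is [crun s]. *)
Lemma sum_keeps_peaks : \sum_i keeps_peaks i = 2 * cpk s + cyc s.
Proof.
under eq_bigr do rewrite keeps_peaksE.
have cycE : \sum_i cycle_min s (s i) = cyc s.
  by rewrite cyc_cycle_min [RHS](reindex_inj (@perm_inj _ s)).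
have cpkE : \sum_i cycle_peak s (s i) = cpk s.
  by rewrite cpk_cycle_peak [RHS](reindex_inj (@perm_inj _ s)).
by rewrite !big_split /= cycE cpkE -cpk_cycle_peak; lia.
Qed.

(** Neither [i] nor [s i] is a peak once the new letter stands between them; the new letter is a
    peak unless it ends its cycle word; all other letters keep their status, and [F] marks the peaks
    among them. *)
Lemma cpk_insert_lift i :
  cpk (insert_max s (lift max i)) + keeps_peaks i = (cpk s).+1.
Proof.
pose F x := [&& cycle_peak s x, x != i & x != s i].
have cpkE : cpk s = \sum_x F x + (cycle_peak s i + cycle_peak s (s i)).
  rewrite cpk_cycle_peak.
  have delta y : \sum_x (if x == y then cycle_peak s y : nat else 0) = cycle_peak s y.
    by rewrite -big_mkcond big_pred1_eq.
  rewrite -(delta i) -(delta (s i)) -!big_split; apply: eq_bigr => x _.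
  rewrite /F; case: (eqVneq x i) => [->|nxi] /=; last first.
    by case: eqP => [->|]; case: cycle_peak.
  (* If [i] is fixed by [s], the two corrections coincide, but both vanish because a fixed point is
     no peak. *)
  rewrite andbF; case: eqP => [e|_]; last by rewrite addn0.
  by rewrite -e /cycle_peak -!e ltnn andbF.
rewrite cpkE cpk_cycle_peak sum_lift_max keeps_peaksE.
have -> : cycle_peak (insert_max s (lift max i)) max = ~~ cycle_min s (s i).
  by rewrite /cycle_peak insert_maxV insert_max_next !lift_lt_max cycle_min_insert_lift.
have -> : \sum_x cycle_peak (insert_max s (lift max i)) (lift max x) = \sum_x F x.
  apply: eq_bigr => x _; rewrite /cycle_peak /F insert_liftV insert_lift.
  case: (eqVneq x (s i)) => [_|nxs].
    by rewrite ltnNge (ltnW (lift_lt_max _)) !andbF.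
  case: (eqVneq x i) => [_|nxi].
    by rewrite [max < _]ltnNge (ltnW (lift_lt_max _)) !andbF.
  by rewrite cycle_min_insert_lift !lift_max !andbT.
by case: cycle_min => /=; lia.
Qed.

(** * Excedances under insertion, and bijectivity of the insertion *)

Lemma exc_sum {m : nat} (u : 'S_m) : exc u = \sum_(x : 'I_m) (x < u x).
Proof. by rewrite /exc -sum1dep_card [LHS]big_mkcond. Qed.

Lemma exc_insert_fixed : exc (insert_max s max) = exc s.
Proof.
rewrite !exc_sum sum_lift_max insert_max_at ltnn addn0.
by apply: eq_bigr => x _; rewrite insert_fixed !lift_max.
Qed.

(** The letter [i] becomes an excedance whether or not it was one, and the new letter maps below
    itself. *)
Lemma exc_insert_lift i :
  exc (insert_max s (lift max i)) = exc s + ~~ (i < s i).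
Proof.
rewrite !exc_sum sum_lift_max insert_max_next ltnNge (ltnW (lift_lt_max _)) addn0.
rewrite (bigD1 i) //= [in RHS](bigD1 i) //= insert_max_at lift_lt_max.
rewrite (eq_bigr (fun x : 'I_n => x < s x : nat)) => [|x nxi].
  by case: (i < s i) => /=; lia.
by rewrite -[bump n x]/(nat_of_ord (lift ord_max x)) insert_lift (negbTE nxi) !lift_max.
Qed.

End InsertMax.

(** The preimage of the new letter recovers [i], which gives injectivity; both sides have (n+1)!
    elements. *)
Lemma insert_max_bij (n : nat) :
  bijective (fun p : 'S_n * 'I_n.+1 => insert_max p.1 p.2).
Proof.
apply: inj_card_bij; last by rewrite card_prod !card_Sn card_ord mulnC.
move=> [s i] [t j] /= e.
have eij : i = j by rewrite -(insert_maxV s i) e insert_maxV.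
move: e; rewrite eij => /mulgI e; congr (_, _); apply/permP => x.
by apply: (@lift_inj _ ord_max); rewrite -!(lift_perm_lift ord_max ord_max) e.
Qed.

(** * The common recurrence *)

Local Open Scope ring_scope.

Lemma sum_insert_max {V : nmodType} {n : nat} (F : 'S_n.+1 -> V) :
  \sum_t F t = \sum_(s : 'S_n) (F (insert_max s ord_max)
                 + \sum_(i < n) F (insert_max s (lift ord_max i))).
Proof.
rewrite (reindex _ (onW_bij _ (insert_max_bij n))) /=.
rewrite -(pair_bigA _ (fun s i => F (insert_max s i))) /=.
apply: eq_bigr => s _; rewrite big_ord_recr /= addrC; congr (_ + _).
apply: eq_bigr => i _; congr (F (insert_max s _)); apply: val_inj.
by apply: esym (lift_max i).
Qed.

Lemma sum_bool_le {n : nat} (b : 'I_n -> bool) : (\sum_i b i <= n)%N.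
Proof.
rewrite -[leqRHS]card_ord -sum1_card; apply: leq_sum => i _; exact: leq_b1.
Qed.

Lemma sum_if_const {V : zmodType} {n : nat} (b : 'I_n -> bool) (p q : V) :
  \sum_i (if b i then p else q) = p *+ (\sum_i b i)%N + q *+ (n - \sum_i b i)%N.
Proof.
have -> : (n - \sum_i b i = \sum_i ~~ b i)%N.
  have : (\sum_i (b i + ~~ b i) = n)%N.
    by rewrite (eq_bigr (fun=> 1%N)) ?sum1_card ?card_ord // => i _; case: (b i).
  rewrite big_split /= => sumE; apply/eqP.
  by rewrite -(eqn_add2l (\sum_i b i)) sumE subnKC ?sum_bool_le.
rewrite -!sumrMnr -big_split; apply: eq_bigr => i _.
by case: (b i); rewrite /= ?mulr0n ?mulr1n ?addr0 ?add0r.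
Qed.

Lemma cyc_le {n : nat} (s : 'S_n) : (cyc s <= n)%N.
Proof. by rewrite cyc_cycle_min sum_bool_le. Qed.

Lemma exc_le {n : nat} (s : 'S_n) : (exc s <= n)%N.
Proof. by rewrite exc_sum sum_bool_le. Qed.

Lemma crun_le {n : nat} (s : 'S_n) : (crun s <= n)%N.
Proof. by rewrite crun_cpk -sum_keeps_peaks sum_bool_le. Qed.

Definition euler_step (n : nat) (p : {poly int}) : {poly int} :=
  (1 + (2 * n)%:R * 'X) * p + 2%:R * 'X * (1 - 'X) * p^`().

(** Linearity lets the recurrence be checked for each [s] and its [n.+1] insertions separately. *)
Lemma euler_step_sum (n : nat) (I : finType) (F : I -> {poly int}) :
  euler_step n (\sum_i F i) = \sum_i euler_step n (F i).
Proof. by rewrite /euler_step raddf_sum !mulr_sumr -big_split. Qed.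

(** The factor ['X] removes the exponent [k.-1], so that later computations treat [k = 0]
    uniformly. *)
Lemma X_derivXn (k : nat) : 'X * ('X^k)^`() = k%:R * 'X^k :> {poly int}.
Proof.
rewrite derivXn mulr_natl mulrnAr; case: k => [|k]; first by rewrite !mulr0n.
by rewrite -exprS.
Qed.

Lemma deriv_natM (c : nat) (p : {poly int}) : (c%:R * p)^`() = c%:R * p^`().
Proof. by rewrite !mulr_natl derivMn. Qed.

Definition exc_term {n : nat} (s : 'S_n) : {poly int} :=
  'X^(exc s) * (2 ^ (n - cyc s))%:R.

(** A new fixed point raises both [n] and [cyc]. Any other insertion doubles the power of 2; it
    keeps [exc] after an excedance and raises it by 1 after the other [n - exc s] letters. *)
Lemma exc_term_step {n : nat} (s : 'S_n) :
  exc_term (insert_max s ord_max)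
    + \sum_(i < n) exc_term (insert_max s (lift ord_max i))
  = euler_step n (exc_term s).
Proof.
set c := (2 ^ (n - cyc s))%N.
have termE (i : 'I_n) :
  exc_term (insert_max s (lift ord_max i))
  = if (i < s i)%N then 'X^(exc s) * (2 * c)%:R else 'X^((exc s).+1) * (2 * c)%:R.
  rewrite /exc_term exc_insert_lift cyc_insert_max lift_neq_max addn0 subSn ?cyc_le //.
  by rewrite expnS -/c; case: ifP => _; rewrite ?addn0 ?addn1.
rewrite (eq_bigr _ (fun i _ => termE i)) sum_if_const -exc_sum.
rewrite /exc_term exc_insert_fixed cyc_insert_max eqxx addn1 subSS -/c.
rewrite /euler_step [_ * c%:R]mulrC deriv_natM.
have := X_derivXn (exc s); set d := ('X^_)^`() => XdE.
have -> : 2%:R * 'X * (1 - 'X) * (c%:R * d) = 2%:R * (1 - 'X) * c%:R * ('X * d).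
  by ring.
rewrite XdE -(mulr_natr _ (exc s)) -(mulr_natr _ (n - exc s)) exprS.
by rewrite natrB ?exc_le // !natrM; ring.
Qed.

(** Covers both parities: [m = 2i + 1] gives the exponent [i], and [m = 2j + 2] gives [j + 1], which
    absorbs the factor in front of the second sum. *)
Definition peak_monomial (n p m : nat) : {poly int} :=
  (4 ^ p)%:R * ('X^(m./2) * (1 + 'X) ^+ (n - m)).

Definition peak_term {n : nat} (s : 'S_n) : {poly int} :=
  peak_monomial n (cpk s) (crun s).

(** The three terms on the left stand for the new fixed point, the [m] insertions that keep [cpk],
    and the [n - m] insertions that add one peak and hence two runs. *)
Lemma peak_monomial_step (n p m : nat) : (m <= n)%N ->
  peak_monomial n.+1 p m.+1 + (peak_monomial n.+1 p m *+ m
    + peak_monomial n.+1 p.+1 m.+2 *+ (n - m))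
  = euler_step n (peak_monomial n p m).
Proof.
move=> lemn; rewrite /peak_monomial /euler_step deriv_natM derivM.
rewrite [((1 + 'X) ^+ _)^`()]deriv_exp.
rewrite derivD derivX -polyC1 derivC add0r mul1r polyC1.
set k := m./2; set r := (n - m)%N.
have -> : (n.+1 - m)%N = r.+1 by rewrite subSn.
have -> : (n.+1 - m.+1)%N = r by rewrite subSS.
(* For [r = 0] the truncated exponent is harmless, as this term has multiplicity [r]. *)
have -> : (n.+1 - m.+2)%N = r.-1 by rewrite /r; lia.
have -> : (m.+2./2 = k.+1)%N by [].
have -> : 'X^(m.+1./2) = (if odd m then 'X else 1) * 'X^k :> {poly int}.
  by rewrite -uphalfE uphalf_half; case: (odd m); rewrite ?exprS ?mul1r.
have mE : m%:R = (odd m)%:R + 2%:R * k%:R :> {poly int}.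
  by rewrite -natrM -natrD; congr (_%:R); rewrite -[LHS]odd_double_half mul2n.
have nE : (2 * n)%:R = 2%:R * (m%:R + r%:R) :> {poly int}.
  by rewrite -natrD -natrM subnKC.
have := X_derivXn k; set d := ('X^_)^`() => XdE.
set D := (1 + 'X) ^+ r.-1 *+ r.
have YDE : (1 + 'X) * D = r%:R * (1 + 'X) ^+ r :> {poly int}.
  rewrite /D mulrnAr mulr_natl; case: (r) => [|r']; first by rewrite !mulr0n.
  by rewrite -exprS.
have raiseE : (4 ^ p.+1)%:R * ('X^(k.+1) * (1 + 'X) ^+ r.-1) *+ r
    = 4%:R * (4 ^ p)%:R * ('X * 'X^k * D) :> {poly int}.
  by rewrite expnS natrM exprS /D !mulrnAr.
rewrite raiseE -(mulr_natr _ m) nE mE !exprS.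
set c := (4 ^ p)%:R; set P := 'X^k; set Q := (1 + 'X) ^+ r.
(* Splitting 2 as (1 + X) + (1 - X): the second half cancels against the derivative of [Q] on the
   right, and the first is evaluated by [YDE]. *)
have -> : 4%:R * c * ('X * P * D)
    = 2%:R * c * 'X * P * ((1 + 'X) * D) + 2%:R * c * 'X * P * ((1 - 'X) * D).
  by ring.
have -> : 2%:R * 'X * (1 - 'X) * (c * (d * Q + P * D))
    = 2%:R * (1 - 'X) * c * Q * ('X * d) + 2%:R * c * 'X * P * ((1 - 'X) * D).
  by ring.
by rewrite YDE XdE -/P -/Q; case: (odd m); rewrite ?mulr1n ?mulr0n; ring.
Qed.

Lemma peak_term_step {n : nat} (s : 'S_n) :
  peak_term (insert_max s ord_max)
    + \sum_(i < n) peak_term (insert_max s (lift ord_max i))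
  = euler_step n (peak_term s).
Proof.
rewrite /peak_term crun_cpk cpk_insert_fixed cyc_insert_max eqxx addn1 addnS -crun_cpk.
rewrite -peak_monomial_step ?crun_le //; congr (_ + _).
have := sum_if_const (keeps_peaks s) (peak_monomial n.+1 (cpk s) (crun s))
  (peak_monomial n.+1 (cpk s).+1 (crun s).+2).
rewrite sum_keeps_peaks -crun_cpk => <-.
apply: eq_bigr => i _; have := cpk_insert_lift s i.
rewrite crun_cpk cyc_insert_max lift_neq_max addn0 (crun_cpk s).
case: keeps_peaks => e.
  by have -> : cpk (insert_max s (lift ord_max i)) = cpk s by lia.
have -> : cpk (insert_max s (lift ord_max i)) = (cpk s).+1 by lia.
by congr peak_monomial; lia.
Qed.

Lemma sum_exc_term (n : nat) :
  \sum_(s : 'S_n) exc_term s = \sum_(s : 'S_n) peak_term s.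
Proof.
elim: n => [|n IHn]; last first.
  rewrite !sum_insert_max (eq_bigr _ (fun s _ => exc_term_step s)).
  by rewrite (eq_bigr _ (fun s _ => peak_term_step s)) -!euler_step_sum IHn.
(* For [n = 0] all statistics vanish and both terms are 1. *)
apply: eq_bigr => s _; rewrite /exc_term /peak_term /peak_monomial.
rewrite crun_cpk exc_sum cpk_cycle_peak cyc_cycle_min !big_ord0.
by rewrite !expr0 !mulr1.
Qed.

Lemma expn_crun_cyc {n : nat} (s : 'S_n) : (2 ^ (crun s - cyc s) = 4 ^ cpk s)%N.
Proof. by rewrite crun_cpk addnK expnM. Qed.

(** Turns a sum over indices with [xi_plus] ([a = 1]) or [xi_minus] ([a = 2]) as coefficients into a
    sum over permutations. *)
Lemma sum_crun_class (n N a : nat) (M : nat -> {poly int}) :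
  \sum_(0 <= i < N) (\sum_(s in perms_crun n (2 * i + a)) 2 ^ (crun s - cyc s))%:R * M i
  = \sum_(s : 'S_n) \sum_(0 <= i < N | crun s == (2 * i + a)%N) (4 ^ cpk s)%:R * M i.
Proof.
under [RHS]eq_bigr do rewrite big_mkcond.
rewrite [RHS]exchange_big; apply: eq_bigr => i _ /=.
rewrite -big_mkcond natr_sum mulr_suml; apply: eq_big => s; first by rewrite inE.
by rewrite expn_crun_cyc.
Qed.

(** The parity of [crun s] selects one of the two sums, in which a single index survives: [m./2] for
    odd [m], [(m./2).-1] for even [m]. *)
Lemma peak_term_crun {n : nat} (hn : (0 < n)%N) (s : 'S_n) :
  peak_term s =
    \sum_(0 <= i < ((n - 1) %/ 2).+1 | crun s == (2 * i + 1)%N)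
      (4 ^ cpk s)%:R * ('X^i * (1 + 'X) ^+ (n - 1 - 2 * i))
    + \sum_(0 <= j < ((n - 2) %/ 2).+1 | crun s == (2 * j + 2)%N)
      (4 ^ cpk s)%:R * ('X * 'X^j * (1 + 'X) ^+ (n - 2 - 2 * j)).
Proof.
(* Makes [crun s] positive; the value 0 would match no index of either sum. *)
have cyc_gt0 : (0 < cyc s)%N.
  by apply/card_gt0P; exists (porbit s (Ordinal hn)); apply: imset_f.
have := crun_le s; have : (0 < crun s)%N by rewrite crun_cpk; lia.
rewrite /peak_term /peak_monomial; set m := crun s; move: (cpk s) => p m_gt0 lemn.
case: (boolP (odd m)) => oddm.
  rewrite [X in _ = _ + X]big_pred0 ?addr0 => [|j]; last by lia.
  rewrite (eq_bigl (fun i => i == m./2)) => [|i]; last by lia.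
  rewrite big_nat1_eq ifT; last by lia.
  by congr (_ * (_ * _ ^+ _)); lia.
rewrite big_pred0 ?add0r => [|i]; last by lia.
rewrite (eq_bigl (fun j => j == (m./2).-1)) => [|j]; last by lia.
rewrite big_nat1_eq ifT; last by lia.
by rewrite -exprS; congr (_ * ('X^_ * _ ^+ _)); lia.
Qed.

Theorem theorem22 (n : nat) (hn : (2 <= n)%N) :
  [/\ \sum_(s : 'S_n) 'X^(exc s) * (2 ^ (n - cyc s))%:R =
        \sum_(0 <= i < ((n - 1) %/ 2).+1)
          (xi_plus n i)%:R * 'X^i * (1 + 'X) ^+ (n - 1 - 2 * i)
        + 'X * \sum_(0 <= j < ((n - 2) %/ 2).+1)
          (xi_minus n j)%:R * 'X^j * (1 + 'X) ^+ (n - 2 - 2 * j)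
        :> {poly int},
      forall i : nat,
        xi_plus n i = (\sum_(s in perms_crun n (2 * i + 1)) 4 ^ cpk s)%N
    & forall j : nat,
        xi_minus n j = (\sum_(s in perms_crun n (2 * j + 2)) 4 ^ cpk s)%N ].
Proof.
split=> [|i|j]; try by apply: eq_bigr => s _; apply: expn_crun_cyc.
rewrite -/(\sum_(s : 'S_n) exc_term s) sum_exc_term.
rewrite (eq_bigr _ (fun s _ => peak_term_crun (ltnW hn) s)) big_split /=.
rewrite -!sum_crun_class mulr_sumr.
by congr (_ + _); apply: eq_bigr => i _; rewrite /xi_plus /xi_minus; ring.
Qed.
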